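(* Let $N\ge 1$ be an integer, let $\mathbf{x}^{(0)}\in\mathcal{C}=\{\mathbf{x}\in\mathbf{C}^N : |x_n|=1,\ n=1,\ldots,N\}$ be arbitrary, and let $\{\mathbf{x}^{(k)}\}_{k\ge 0}$ be a sequence generated from $\mathbf{x}^{(0)}$ by the MISL algorithm (defined in the context). Then every limit point of the sequence $\{\mathbf{x}^{(k)}\}$ is a stationary point of the problem $$\underset{\mathbf{x}\in\mathbf{C}^N}{\text{minimize}}\ \ \sum_{p=1}^{2N}\left(\mathbf{a}_p^H\mathbf{x}\mathbf{x}^H\mathbf{a}_p\right)^2\quad\text{subject to } |x_n|=1,\ n=1,\ldots,N.$$
   Context: Notation: $j=\sqrt{-1}$; $(\cdot)^H$ denotes conjugate transpose; $\mathrm{Diag}(\mathbf{p})$ is the diagonal matrix with $\mathbf{p}$ on its diagonal. For $p=1,\ldots,2N$ let $\omega_p=\frac{2\pi}{2N}(p-1)$ and $\mathbf{a}_p=[1,e^{j\omega_p},\ldots,e^{j\omega_p(N-1)}]^T\in\mathbf{C}^N$, and let $\mathbf{A}=[\mathbf{a}_1,\ldots,\mathbf{a}_{2N}]\in\mathbf{C}^{N\times 2N}$. MISL algorithm: given $\mathbf{x}^{(k)}\in\mathcal{C}$, compute - $\mathbf{p}^{(k)}\in\mathbf{R}^{2N}$ with entries $p_p^{(k)}=|\mathbf{a}_p^H\mathbf{x}^{(k)}|^2$, $p=1,\ldots,2N$; - $p_{\max}^{(k)}=\max_{1\le p\le 2N}p_p^{(k)}$; - $\mathbf{y}=-\mathbf{A}\left(\mathrm{Diag}(\mathbf{p}^{(k)})-p_{\max}^{(k)}\mathbf{I}-N^2\mathbf{I}\right)\mathbf{A}^H\mathbf{x}^{(k)}$;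 - $x_n^{(k+1)}=e^{j\arg(y_n)}$, $n=1,\ldots,N$ (if $y_n=0$, $\arg(y_n)$ may be any real number). The sequence $\{\mathbf{x}^{(k)}\}_{k\ge0}$ is obtained by iterating this step indefinitely. Stationary point: for a smooth function $h:\mathbf{R}^m\to\mathbf{R}$ and a subset $\mathcal{X}\subseteq\mathbf{R}^m$, a point $\mathbf{z}\in\mathcal{X}$ is a stationary point of the problem of minimizing $h$ over $\mathcal{X}$ if $\nabla h(\mathbf{z})^T\mathbf{d}\ge 0$ for all $\mathbf{d}\in T_{\mathcal{X}}(\mathbf{z})$, where $T_{\mathcal{X}}(\mathbf{z})$ is the tangent cone of $\mathcal{X}$ at $\mathbf{z}$, i.e. the set consisting of $\mathbf{0}$ and of all nonzero $\mathbf{d}$ for which there is a sequence $\mathbf{z}_i\in\mathcal{X}$, $\mathbf{z}_i\ne\mathbf{z}$, $\mathbf{z}_i\to\mathbf{z}$, with $\frac{\mathbf{z}_i-\mathbf{z}}{\|\mathbf{z}_i-\mathbf{z}\|}\to\frac{\mathbf{d}}{\|\mathbf{d}\|}$. For the complex problem in the claim, $\mathbf{x}\in\mathcal{C}$ is called a stationary point if $\tilde{\mathbf{x}}=[\mathrm{Re}(\mathbf{x})^T,\mathrm{Im}(\mathbf{x})^T]^T\in\mathbf{R}^{2N}$ is a stationary point of the equivalent real problem of minimizing $\sum_{p=1}^{2N}(\tilde{\mathbf{x}}^T\tilde{\mathbf{A}}_p\tilde{\mathbf{x}})^2$ over $\{\tilde{\mathbf{x}}\in\mathbf{R}^{2N}:\tilde{x}_n^2+\tilde{x}_{n+N}^2=1,\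 n=1,\ldots,N\}$, where $\mathbf{A}_p=\mathbf{a}_p\mathbf{a}_p^H$ and $$\tilde{\mathbf{A}}_p=\begin{bmatrix}\mathrm{Re}(\mathbf{A}_p)&-\mathrm{Im}(\mathbf{A}_p)\\ \mathrm{Im}(\mathbf{A}_p)&\mathrm{Re}(\mathbf{A}_p)\end{bmatrix}.$$ *)

(* Defs.v *)
From mathcomp Require Import all_boot all_order all_algebra ring.
From mathcomp Require Import boolp classical_sets reals topology normedtype.
From mathcomp Require Import derive trigo sequences.
From mathcomp Require Import complex.

Set Implicit Arguments.
Unset Strict Implicit.
Unset Printing Implicit Defensive.

Import Order.TTheory GRing.Theory Num.Theory.
Import numFieldNormedType.Exports.

Local Open Scope classical_set_scope.
Local Open Scope ring_scope.
Local Open Scope complex_scope.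
Local Open Scope sesquilinear_scope.

(* ['cV[R]_m] carries the sup norm in the library, so the Euclidean norm
   is spelled out. *)
Definition enorm (R : realType) m (v : 'cV[R]_m) : R :=
  Num.sqrt (\sum_i v i 0 ^+ 2).

Definition gradient (R : realType) m (h : 'cV[R]_m -> R) (z : 'cV[R]_m) :
    'cV[R]_m :=
  \col_i 'D_(delta_mx i 0) h z.

Definition tangent_cone (R : realType) m (X : set 'cV[R]_m) (z : 'cV[R]_m) :
    set 'cV[R]_m :=
  [set d | d = 0 \/
    (d <> 0 /\ exists u : nat -> 'cV[R]_m,
      [/\ forall i, X (u i) /\ u i <> z,
          u @ \oo --> z &
          (fun i => (enorm (u i - z))^-1 *: (u i - z)) @ \oo -->
            (enorm d)^-1 *: d])].

Definition stationary_point (R : realType) m (h : 'cV[R]_m -> R)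
    (X : set 'cV[R]_m) (z : 'cV[R]_m) : Prop :=
  X z /\ forall d, tangent_cone X z d -> 0 <= ((gradient h z)^T *m d) 0 0.

Definition expi (R : realType) (t : R) : R[i] := cos t +i* sin t.

(* Arguments are not normalized to an interval; every real is an argument
   of 0. *)
Definition is_arg (R : realType) (y : R[i]) (t : R) : Prop :=
  y = `|y| * expi t.

(* Indices start at 0: [p : 'I_(2 * N)] stands for p + 1 in 1, ..., 2N. *)
Definition omega (R : realType) N (p : 'I_(2 * N)) : R :=
  2 * pi / (2 * N)%:R * p%:R.

Definition avec (R : realType) N (p : 'I_(2 * N)) : 'cV[R[i]]_N :=
  \col_n expi (omega R p * n%:R).

Definition Amx (R : realType) N : 'M[R[i]]_(N, 2 * N) :=
  \matrix_(n, p) avec R p n 0.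

Definition unimodular (R : realType) N : set 'cV[R[i]]_N :=
  [set x | forall n, `|x n 0| = 1].

Definition spectrum (R : realType) N (x : 'cV[R[i]]_N) : 'rV[R]_(2 * N) :=
  \row_p Normc.normc (((avec R p)^t* *m x) 0 0) ^+ 2.

(* The entries are nonnegative, so starting the maximum at 0 is harmless
   when 0 < N. *)
Definition spectrum_max (R : realType) N (x : 'cV[R[i]]_N) : R :=
  \big[Num.max/0]_p spectrum x 0 p.

Definition misl_y (R : realType) N (x : 'cV[R[i]]_N) : 'cV[R[i]]_N :=
  - (Amx R N *m (diag_mx (map_mx (real_complex R) (spectrum x))
                 - ((spectrum_max x)%:C)%:M - (N%:R ^+ 2)%:M)
            *m (Amx R N)^t* *m x).

(* A relation rather than a function: the phase is free wherever [misl_y x]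
   vanishes. *)
Definition misl_step (R : realType) N (x x' : 'cV[R[i]]_N) : Prop :=
  forall n, exists2 t : R, is_arg (misl_y x n 0) t & x' n 0 = expi t.

Definition objective (R : realType) N (x : 'cV[R[i]]_N) : R[i] :=
  \sum_(p < 2 * N) (((avec R p)^t* *m x *m x^t* *m avec R p) 0 0) ^+ 2.

Definition realify (R : realType) N (x : 'cV[R[i]]_N) : 'cV[R]_(N + N) :=
  col_mx (map_mx (@complex.Re R) x) (map_mx (@complex.Im R) x).

Definition realify_mx (R : realType) N (M : 'M[R[i]]_N) : 'M[R]_(N + N) :=
  block_mx (map_mx (@complex.Re R) M) (- map_mx (@complex.Im R) M)
           (map_mx (@complex.Im R) M) (map_mx (@complex.Re R) M).

Definition real_objective (R : realType) N (z : 'cV[R]_(N + N)) : R :=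
  \sum_(p < 2 * N)
    ((z^T *m realify_mx (avec R p *m (avec R p)^t*) *m z) 0 0) ^+ 2.

Definition real_feasible (R : realType) N : set 'cV[R]_(N + N) :=
  [set z | forall n : 'I_N, z (lshift N n) 0 ^+ 2 + z (rshift N n) 0 ^+ 2 = 1].

(* Stationarity for minimizing [objective] over [unimodular]; the lemmas
   [objectiveE] and [unimodularE] relate the two problems. *)
Definition complex_stationary (R : realType) N (x : 'cV[R[i]]_N) : Prop :=
  unimodular x /\
  stationary_point (@real_objective R N) (@real_feasible R N) (realify x).

(* [R[i]^o] is [R[i]] with the topology of its modulus, so that ['cV_N] gets
   the usual topology of C^N. *)
Definition limit_point_of (R : realType) N (x : nat -> 'cV[R[i]]_N)
    (z : 'cV[R[i]]_N) : Prop :=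
  cluster ((x : nat -> 'cV[R[i]^o]_N) @ \oo) z.

Lemma unimodularE (R : realType) N (x : 'cV[R[i]]_N) :
  unimodular x <-> real_feasible (realify x).
Proof.
rewrite /unimodular /real_feasible /realify /=.
split=> H n; have := H n; rewrite ?col_mxEu ?col_mxEd !mxE.
  by move/(congr1 (fun z => z ^+ 2)); rewrite normc_def -rmorphXn expr1n
    sqr_sqrtr ?addr_ge0 ?sqr_ge0 // => -[].
by move=> h; rewrite normc_def h sqrtr1.
Qed.

Lemma realify_mxM (R : realType) N (M : 'M[R[i]]_N) (x : 'cV[R[i]]_N) :
  realify_mx M *m realify x = realify (M *m x).
Proof.
have ReS := raddf_sum (@complex.Re R : Rcomplex R -> R).
have ImS := raddf_sum (@complex.Im R : Rcomplex R -> R).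
rewrite /realify_mx /realify mul_block_col mulNmx; congr col_mx;
  apply/matrixP=> i j; rewrite !mxE ?(ReS, ImS) -?sumrB -?big_split /=;
  apply: eq_bigr => k _; rewrite !mxE; case: (M i k) (x k j) => a b [c d] //=.
by rewrite addrC.
Qed.

Lemma realify_dot (R : realType) N (x y : 'cV[R[i]]_N) :
  ((realify x)^T *m realify y) 0 0 = complex.Re ((x^t* *m y) 0 0).
Proof.
have ReS := raddf_sum (@complex.Re R : Rcomplex R -> R).
rewrite /realify tr_col_mx mul_row_col !mxE ReS -big_split /=.
apply: eq_bigr => k _; rewrite !mxE; case: (x k 0) (y k 0) => a b [c d] /=.
by rewrite mulNr opprK.
Qed.

Lemma objectiveE (R : realType) N (x : 'cV[R[i]]_N) :
  objective x = (real_objective (realify x))%:C.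
Proof.
rewrite /objective /real_objective rmorph_sum; apply: eq_bigr => p _ /=.
rewrite rmorphXn; congr (_ ^+ 2).
set s := (avec R p)^t* *m x; set t := x^t* *m avec R p.
have ts : t 0 0 = (s 0 0)^*%C.
  rewrite /s /t !mxE rmorph_sum; apply: eq_bigr => k _ /=.
  by rewrite !mxE rmorphM mulrC; congr (_ * _); exact/esym/conjcK.
have -> : s *m x^t* *m avec R p = s *m t by rewrite -mulmxA.
rewrite -[in RHS]mulmxA realify_mxM realify_dot.
have ->: x^t* *m (avec R p *m (avec R p)^t* *m x) = t *m s.
  by rewrite /s /t !mulmxA.
rewrite [in LHS]mxE [in RHS]mxE !big_ord1 ts.
by case: (s 0 0) => a b /=; congr (_ +i* _); ring.
Qed.

(* Main.v *)
Require Import Defs.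
From mathcomp Require Import all_boot all_order all_algebra ring lra.
From mathcomp Require Import boolp classical_sets reals topology normedtype.
From mathcomp Require Import derive trigo sequences.
From mathcomp Require Import complex.

(** Every limit point of MISL annihilates the nonnegative quantity
    [phase_gap x = sum_n (|y_n| - Re (conj y_n x_n))], and on the torus this
    forces stationarity.

    Write p, q for the spectra of consecutive iterates x, x' and s, t for the
    vectors A^H x', A^H x.  Cauchy-Schwarz for a_p and
    conj(s_p) x' - conj(t_p) x together with A A^H = 2N I gives
    sum (q_p - p_p)^2 <= 4 N^2 (N^2 - |c|^2), where c = x'^H x.
    Adding the linear terms, with weights p_max - p_p + N^2 >= N^2, leaves
    -4 N^2 |c - N|^2 <= 0, i.e. E(x') + 4 phase_gap x <= E(x) for
    E = sum p_p^2.  As E >= 0, phase_gap (x_k) tends to 0, and by continuity it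
    vanishes at every limit point z.  Then y_n = |y_n| z_n (no choice of phase
    at y_n = 0 matters), so the gradient of E at z, which is
    4 (2N (p_max + N^2) z - y), is in each coordinate a real multiple of z_n,
    hence orthogonal to the tangent cone. *)

Set Implicit Arguments.
Unset Strict Implicit.
Unset Printing Implicit Defensive.

Import Order.TTheory GRing.Theory Num.Theory.
Import numFieldNormedType.Exports.

(* [ring_scope] is opened after [complex_scope] so that [x^*] denotes
   [Num.conj] and not [conjc]. *)
Local Open Scope complex_scope.
Local Open Scope classical_set_scope.
Local Open Scope ring_scope.
Local Open Scope sesquilinear_scope.

(** * Cauchy-Schwarz and the abstract descent inequality *)

Definition dotc (C : numClosedFieldType) n (u v : 'I_n -> C) : C :=
  \sum_i (u i)^* * v i.

(** Cauchy-Schwarz for [a] and v = conj(s) x - conj(t) w: the pairing of [a] with v is |s|^2 -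
    |t|^2, the squared norm of [a] is n, and the second factor on the right is the squared norm of
    v. *)
Lemma sqr_gap_le (C : numClosedFieldType) n (a x w : 'I_n -> C)
    (ha : forall i, `|a i| = 1) (hx : forall i, `|x i| = 1)
    (hw : forall i, `|w i| = 1) :
  (dotc a x * (dotc a x)^* - dotc a w * (dotc a w)^*) ^+ 2 <=
    n%:R * (n%:R * (dotc a x * (dotc a x)^*) + n%:R * (dotc a w * (dotc a w)^*)
            - dotc a x * (dotc a w)^* * dotc x w
            - (dotc a x)^* * dotc a w * (dotc x w)^*).
Proof.
set s := dotc a x; set t := dotc a w; set c := dotc x w.
have sq1 (f : 'I_n -> C) : (forall i, `|f i| = 1) ->
    forall i, f i * (f i)^* = 1.
  by move=> hf i; rewrite -normCK hf expr1n.
pose d := s * s^* - t * t^*.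
pose v i := s^* * x i - t^* * w i.
have dconj : d^* = d by rewrite /d rmorphB !rmorphM /= !conjCK; ring.
have sumav : \sum_i (a i)^* * v i = d.
  rewrite /v /d mulrC [t * _]mulrC [in s^* * s]/s [in t^* * t]/t !mulr_sumr.
  by rewrite -sumrB; apply: eq_bigr => i _; ring.
have sumva : \sum_i a i * (v i)^* = d.
  rewrite -[RHS]dconj -[in RHS]sumav rmorph_sum; apply: eq_bigr => i _.
  by rewrite rmorphM /= conjCK.
have cc : c^* = \sum_i x i * (w i)^*.
  by rewrite rmorph_sum; apply: eq_bigr => i _; rewrite rmorphM /= conjCK.
have sumvv : \sum_i v i * (v i)^* = n%:R * (s * s^*) + n%:R * (t * t^*)
            - s * t^* * c - s^* * t * c^*.
  have sum1 (e : C) : n%:R * e = \sum_(i < n) e.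
    by rewrite sumr_const card_ord mulr_natl.
  rewrite cc !sum1 [_ * _ * c]mulr_sumr [s^* * t * _]mulr_sumr -big_split.
  rewrite -!sumrB /=; apply: eq_bigr => i _.
  rewrite /v rmorphB !rmorphM /= !conjCK.
  have ex := sq1 _ hx i; have ew := sq1 _ hw i.
  transitivity (s * s^* * (x i * (x i)^*) + t * t^* * (w i * (w i)^*)
    - s * t^* * ((x i)^* * w i) - s^* * t * (x i * (w i)^*)); first by ring.
  by rewrite ex ew !mulr1.
rewrite -sumvv -/d.
(* The empty case is split off because the projection coefficient below is d / n. *)
have [n0|n_gt0] := posnP n.
  rewrite -sumav big1 ?expr0n /= => [|i _]; last first.
    by have := ltn_ord i; rewrite [X in (_ < X)%N]n0.
  by rewrite mulr_ge0 // sumr_ge0 // => i _; exact: mul_conjC_ge0.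
have nz : n%:R != 0 :> C by rewrite pnatr_eq0 -lt0n.
(* Since [a] has squared norm n, d / n * a is the projection of v on [a]; the squared norm of the
   residual is (n |v|^2 - d^2) / n. *)
have : 0 <= \sum_i (v i - d / n%:R * a i) * (v i - d / n%:R * a i)^*.
  by apply: sumr_ge0 => i _; exact: mul_conjC_ge0.
suff -> : \sum_i (v i - d / n%:R * a i) * (v i - d / n%:R * a i)^* =
   (n%:R * (\sum_i v i * (v i)^*) - d ^+ 2) / n%:R.
  by rewrite pmulr_lge0 ?invr_gt0 ?ltr0n // subr_ge0.
have e1 : forall i, (v i - d / n%:R * a i) * (v i - d / n%:R * a i)^* =
   v i * (v i)^* - d / n%:R * ((a i)^* * v i) - d / n%:R * (a i * (v i)^*)
    + (d / n%:R) ^+ 2.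
  move=> i; rewrite rmorphB !rmorphM fmorphV rmorph_nat /= dconj.
  rewrite -[in RHS](mulr1 ((d / _) ^+ 2)) -(sq1 _ ha i); ring.
rewrite (eq_bigr _ (fun i _ => e1 i)) big_split /= !sumrB -!mulr_sumr.
rewrite sumav sumva sumr_const card_ord -mulr_natl; by field.
Qed.

(** Stated for any A with unimodular entries and orthogonal rows of squared norm m. Here [x] is the
    next iterate, [w] the current one, and [b] will be p_max. *)
Lemma misl_descent (C : numClosedFieldType) m n (A : 'I_n -> 'I_m -> C)
    (x w : 'I_n -> C) (b : C)
    (hA : forall i p, `|A i p| = 1)
    (hAA : forall i j, \sum_p A i p * (A j p)^* = m%:R *+ (i == j))
    (hx : forall i, `|x i| = 1) (hw : forall i, `|w i| = 1) :
  let s p := dotc (A^~ p) x in let t p := dotc (A^~ p) w in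
  (forall p, t p * (t p)^* <= b) ->
  \sum_p (s p * (s p)^*) ^+ 2
   + 2 * \sum_p (b - t p * (t p)^* + n%:R ^+ 2) *
       ((s p)^* * t p + s p * (t p)^* - 2 * (t p * (t p)^*))
   <= \sum_p (t p * (t p)^*) ^+ 2.
Proof.
move=> s t hb.
have parseval (f g : 'I_n -> C) :
    \sum_p (dotc (A^~ p) f)^* * dotc (A^~ p) g = m%:R * dotc f g.
  transitivity (\sum_p \sum_i \sum_j (A i p * (A j p)^*) * ((f i)^* * g j)).
    apply: eq_bigr => p _; rewrite rmorph_sum mulr_suml; apply: eq_bigr => i _.
    rewrite mulr_sumr; apply: eq_bigr => j _.
    by rewrite rmorphM /= conjCK; ring.
  rewrite exchange_big mulr_sumr; apply: eq_bigr => i _ /=.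
  rewrite exchange_big (bigD1 i) //= -mulr_suml hAA eqxx mulr1n.
  rewrite big1 ?addr0 // => j ji.
  by rewrite -mulr_suml hAA eq_sym (negbTE ji) mulr0n mul0r.
have sum1 (f : 'I_n -> C) : (forall i, `|f i| = 1) ->
    dotc f f = n%:R.
  move=> hf; rewrite -[n in RHS]card_ord -sumr_const; apply: eq_bigr => i _.
  by rewrite mulrC -normCK hf expr1n.
pose c := dotc x w.
have Sss : \sum_p s p * (s p)^* = m%:R * n%:R.
  by rewrite -(sum1 _ hx) -parseval; apply: eq_bigr => p _; rewrite mulrC.
have Stt : \sum_p t p * (t p)^* = m%:R * n%:R.
  by rewrite -(sum1 _ hw) -parseval; apply: eq_bigr => p _; rewrite mulrC.
have Sst : \sum_p (s p)^* * t p = m%:R * c by rewrite -parseval.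
have Sts : \sum_p s p * (t p)^* = m%:R * c^*.
  rewrite -(rmorph_nat Num.conj) -rmorphM -Sst rmorph_sum.
  by apply: eq_bigr => p _; rewrite rmorphM /= conjCK.
have le1 p : (s p * (s p)^* - t p * (t p)^*) ^+ 2 <=
    n%:R * (n%:R * (s p * (s p)^*) + n%:R * (t p * (t p)^*)
            - s p * (t p)^* * c - (s p)^* * t p * c^*).
  exact: (sqr_gap_le (hA^~ p) hx hw).
rewrite -subr_le0.
(* From 2 Re(conj(s) t) - 2 |t|^2 = |s|^2 - |t|^2 - |s - t|^2, each summand equals (|s|^2 - |t|^2)^2
   + 2 (b + n^2) (|s|^2 - |t|^2) - 2 (b - |t|^2 + n^2) |s - t|^2. [U] replaces the square by its
   Cauchy-Schwarz bound and the last weight by n^2, which is allowed because |t|^2 <= b. *)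
pose U p := n%:R * (n%:R * (s p * (s p)^*) + n%:R * (t p * (t p)^*)
            - s p * (t p)^* * c - (s p)^* * t p * c^*)
  + 2 * (b + n%:R ^+ 2) * (s p * (s p)^* - t p * (t p)^*)
  - 2 * n%:R ^+ 2 * (s p * (s p)^* + t p * (t p)^*
                     - (s p)^* * t p - s p * (t p)^*).
have -> : \sum_p (s p * (s p)^*) ^+ 2
   + 2 * (\sum_p (b - t p * (t p)^* + n%:R ^+ 2) *
       ((s p)^* * t p + s p * (t p)^* - 2 * (t p * (t p)^*)))
   - \sum_p (t p * (t p)^*) ^+ 2 = \sum_p ((s p * (s p)^*) ^+ 2
    + 2 * ((b - t p * (t p)^* + n%:R ^+ 2) *
       ((s p)^* * t p + s p * (t p)^* - 2 * (t p * (t p)^*)))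
    - (t p * (t p)^*) ^+ 2).
  by rewrite sumrB big_split mulr_sumr.
apply: (@le_trans _ _ (\sum_p U p)).
  apply: ler_sum => p _; rewrite -subr_ge0.
  set e := (X in 0 <= X).
  have -> : e = (n%:R * (n%:R * (s p * (s p)^*) + n%:R * (t p * (t p)^*)
            - s p * (t p)^* * c - (s p)^* * t p * c^*)
       - (s p * (s p)^* - t p * (t p)^*) ^+ 2)
     + 2 * (b - t p * (t p)^*) * ((s p - t p) * (s p - t p)^*).
    by rewrite /e /U rmorphB /=; ring.
  apply: addr_ge0; first by rewrite subr_ge0.
  apply: mulr_ge0; last exact: mul_conjC_ge0.
  by apply: mulr_ge0; rewrite ?ler0n // subr_ge0.
(* The terms with b + n^2 cancel, as s and t both have squared norm m n; the rest completes a square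
   in c. *)
have -> : \sum_p U p = - (2 * m%:R * n%:R * ((c - n%:R) * (c - n%:R)^*)).
  rewrite /U sumrB big_split /= -!mulr_sumr !sumrB !big_split /=.
  rewrite -!mulr_sumr -!mulr_suml Sss Stt Sst Sts rmorphB rmorph_nat /=; ring.
by rewrite oppr_le0 mulr_ge0 ?mul_conjC_ge0 // !mulr_ge0 ?ler0n.
Qed.

(** * Complex exponentials and the identity A A^H = 2N I *)

Lemma expiD (R : realType) (a b : R) : expi (a + b) = expi a * expi b.
Proof. by rewrite /expi cosD sinD; congr (_ +i* _); rewrite addrC. Qed.

Lemma expi0 (R : realType) : expi (0 : R) = 1.
Proof. by rewrite /expi cos0 sin0. Qed.

Lemma conj_expi (R : realType) (a : R) : (expi a)^* = expi (- a).
Proof. by rewrite /expi cosN sinN. Qed.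

Lemma norm_expi (R : realType) (a : R) : `|expi a| = 1.
Proof. by rewrite normc_def /= cos2Dsin2 sqrtr1. Qed.

Lemma expiX (R : realType) (a : R) n : expi (a * n%:R) = expi a ^+ n.
Proof.
elim: n => [|n IH]; first by rewrite mulr0 expi0.
by rewrite -natr1 mulrDr mulr1 expiD IH exprSr.
Qed.

Lemma expi_neq1 (R : realType) (a : R) : 0 < a < pi -> expi a != 1.
Proof.
move=> a0pi; apply/eqP => -[_ s0].
by have := sin_gt0_pi a0pi; rewrite s0 ltxx.
Qed.

(** A geometric series whose ratio r = exp(i pi k / N) satisfies r^(2N) = 1, and r is not 1 because
    k < N keeps its angle strictly between 0 and pi. *)
Lemma sum_expi_eq0 (R : realType) N k : (0 < k < N)%N ->
  \sum_(p < 2 * N) expi (omega R p * k%:R) = 0.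
Proof.
move=> /andP[k0 kN]; have N0 : (0 < N)%N by apply: leq_trans kN.
have NR : (0 : R) < N%:R by rewrite ltr0n.
pose r : R[i] := expi (pi / N%:R * k%:R).
have e1 (p : 'I_(2 * N)) : expi (omega R p * k%:R) = r ^+ p.
  rewrite /r -expiX /omega; congr expi; rewrite natrM; field.
  by rewrite gt_eqF.
rewrite (eq_bigr _ (fun p _ => e1 p)).
have r1 : r - 1 != 0.
  rewrite subr_eq0; apply: expi_neq1.
  rewrite mulr_gt0 ?divr_gt0 ?pi_gt0 ?ltr0n //=.
  by rewrite mulrAC ltr_pdivrMr // ltr_pM2l ?pi_gt0 // ltr_nat.
apply: (mulfI r1); rewrite mulr0 -subrX1 /r -expiX.
have -> : pi / N%:R * k%:R * (2 * N)%:R = (pi *+ 2) * k%:R :> R.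
  by rewrite natrM; field; rewrite gt_eqF.
by rewrite expiX /expi -[pi *+ 2]add0r cosD2pi sinD2pi cos0 sin0 expr1n subrr.
Qed.

(** Each product depends only on the difference of the row indices, so off the diagonal
    [sum_expi_eq0] applies; conjugation reduces i < j to a positive difference. *)
Lemma Amx_gram (R : realType) N (i j : 'I_N) :
  \sum_p Amx R N i p * (Amx R N j p)^* = (2 * N)%:R *+ (i == j).
Proof.
have e1 (i' j' : 'I_N) p : Amx R N i' p * (Amx R N j' p)^* =
    expi (omega R p * (i'%:R - j'%:R)).
  by rewrite !mxE conj_expi -expiD mulrBr.
case: (ltngtP i j) => [ij|ji|/val_inj <-].
- have -> : (i == j) = false by apply/eqP => e; rewrite e ltnn in ij.
  transitivity ((\sum_p Amx R N j p * (Amx R N i p)^*)^*).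
    rewrite rmorph_sum; apply: eq_bigr => p _.
    by rewrite rmorphM /= conjCK mulrC.
  rewrite (eq_bigr _ (fun p _ => e1 _ _ p)).
  rewrite -(natrB _ (ltnW ij)) sum_expi_eq0 ?conjC0 //.
  by rewrite subn_gt0 ij (leq_ltn_trans (leq_subr _ _)).
- have -> : (i == j) = false by apply/eqP => e; rewrite e ltnn in ji.
  rewrite (eq_bigr _ (fun p _ => e1 _ _ p)).
  rewrite -(natrB _ (ltnW ji)) sum_expi_eq0 //.
  by rewrite subn_gt0 ji (leq_ltn_trans (leq_subr _ _)).
rewrite eqxx mulr1n (eq_bigr (fun=> 1)) ?sumr_const ?card_ord // => p _.
by rewrite e1 subrr mulr0 expi0.
Qed.

Lemma norm_Amx (R : realType) N (i : 'I_N) p : `|Amx R N i p| = 1.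
Proof. by rewrite !mxE norm_expi. Qed.

(** * The update seen through A^H x, the length-2N transform of zero-padded x *)

Definition freq (R : realType) N (x : 'cV[R[i]]_N) p : R[i] :=
  dotc (Amx R N ^~ p) (x ^~ 0).

Lemma freqE (R : realType) N (x : 'cV[R[i]]_N) p :
  ((avec R p)^t* *m x) 0 0 = freq x p.
Proof. by rewrite mxE; apply: eq_bigr => i _; rewrite !mxE. Qed.

Lemma spectrumE (R : realType) N (x : 'cV[R[i]]_N) p :
  (spectrum x 0 p)%:C = freq x p * (freq x p)^*.
Proof. by rewrite mxE freqE rmorphXn /= -normCK. Qed.

(** Diagonal of W, where y = A W A^H x: the sign in front of the update is absorbed here. *)
Definition misl_weight (R : realType) N (x : 'cV[R[i]]_N) p : R :=
  spectrum_max x - spectrum x 0 p + N%:R ^+ 2.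

Lemma misl_yE (R : realType) N (x : 'cV[R[i]]_N) n :
  misl_y x n 0 = \sum_p (misl_weight x p)%:C * freq x p * Amx R N n p.
Proof.
rewrite /misl_y -mulmxA mxE mxE -sumrN.
apply: eq_bigr => p _.
have -> : ((Amx R N)^t* *m x) p 0 = freq x p.
  by rewrite mxE; apply: eq_bigr => i _; rewrite !mxE.
have -> : (Amx R N *m (diag_mx (map_mx (real_complex R) (spectrum x))
                 - ((spectrum_max x)%:C)%:M - (N%:R ^+ 2)%:M)) n p =
   - (Amx R N n p * (misl_weight x p)%:C).
  rewrite -addrA -opprD mulmxBr mulmxDr mul_mx_diag !mul_mx_scalar !mxE.
  rewrite /misl_weight rmorphD rmorphB /= [(N%:R ^+ 2)%:C]rmorphXn /=.
  rewrite rmorph_nat !mxE; ring.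
ring.
Qed.

Lemma spectrum_le_max (R : realType) N (x : 'cV[R[i]]_N) p :
  spectrum x 0 p <= spectrum_max x.
Proof. exact: le_bigmax. Qed.

Lemma normc_norm (R : realType) (a : R[i]) : (Normc.normc a)%:C = `|a|.
Proof. by []. Qed.

Lemma conj_real_complex (R : realType) (a : R) : (a%:C)^* = a%:C.
Proof. by rewrite /Num.conj /= oppr0. Qed.

(** With y = A W A^H x, this moves A across the inner product v^H y. *)
Lemma sum_misl_weight (R : realType) N (x v : 'cV[R[i]]_N) :
  \sum_p (misl_weight x p)%:C * freq x p * (freq v p)^* =
  \sum_n misl_y x n 0 * (v n 0)^*.
Proof.
under [RHS]eq_bigr do rewrite misl_yE mulr_suml.
rewrite exchange_big; apply: eq_bigr => p _ /=.
rewrite [freq v p]/freq /dotc rmorph_sum mulr_sumr; apply: eq_bigr => n _.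
by rewrite rmorphM /= conjCK; ring.
Qed.

Lemma sum_misl_weight_conj (R : realType) N (x v : 'cV[R[i]]_N) :
  \sum_p (misl_weight x p)%:C * (freq x p)^* * freq v p =
  \sum_n (misl_y x n 0)^* * v n 0.
Proof.
apply: (can_inj conjCK); rewrite !rmorph_sum /=.
under eq_bigr do rewrite !rmorphM /= conjCK conj_real_complex.
under [RHS]eq_bigr do rewrite rmorphM /= conjCK.
exact: sum_misl_weight.
Qed.

(** * Energy, phase gap and descent along one step *)

Definition energy (R : realType) N (x : 'cV[R[i]]_N) : R :=
  \sum_p spectrum x 0 p ^+ 2.

Definition phase_gap (R : realType) N (x : 'cV[R[i]]_N) : R :=
  \sum_n (Normc.normc (misl_y x n 0)
          - complex.Re ((misl_y x n 0)^* * x n 0)).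

Lemma Re_mulC2 (R : realType) (y v : R[i]) :
  (2 * complex.Re (y^* * v))%:C = y^* * v + y * v^*.
Proof. by case: y v => a b [c d]; congr (_ +i* _) => /=; ring. Qed.

Lemma misl_step_unimodular (R : realType) N (x x' : 'cV[R[i]]_N) :
  misl_step x x' -> unimodular x'.
Proof. by move=> h n; have [t _ ->] := h n; rewrite norm_expi. Qed.

(** [misl_descent] with b = p_max. By [sum_misl_weight] its linear term becomes a sum over n of 2
    Re(conj(y_n) (x'_n - x_n)), and the choice of phase turns conj(y_n) x'_n into |y_n|. *)
Lemma energy_descent (R : realType) N (x x' : 'cV[R[i]]_N) :
  unimodular x -> misl_step x x' -> energy x' + 4 * phase_gap x <= energy x.
Proof.
move=> ux st; have ux' := misl_step_unimodular st.
have hb p : freq x p * (freq x p)^* <= (spectrum_max x)%:C.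
  by rewrite -spectrumE lecR spectrum_le_max.
have : \sum_p (freq x' p * (freq x' p)^*) ^+ 2
    + 2 * (\sum_p ((spectrum_max x)%:C - freq x p * (freq x p)^* + N%:R ^+ 2) *
        ((freq x' p)^* * freq x p + freq x' p * (freq x p)^*
         - 2 * (freq x p * (freq x p)^*)))
    <= \sum_p (freq x p * (freq x p)^*) ^+ 2.
  exact: (misl_descent (@norm_Amx R N) (@Amx_gram R N) ux' ux hb).
have sqE (v : 'cV[R[i]]_N) :
    \sum_p (freq v p * (freq v p)^*) ^+ 2 = (energy v)%:C.
  rewrite /energy rmorph_sum; apply: eq_bigr => p _.
  by rewrite -spectrumE rmorphXn.
rewrite !sqE; set S := \sum_p _.
suff -> : S = (2 * phase_gap x)%:C.
  rewrite -(rmorph_nat (real_complex R) 2) -rmorphM -rmorphD lecR.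
  by apply: le_trans; rewrite lerD2l; lra.
have -> : S = \sum_p (misl_weight x p)%:C * (freq x p)^* * freq x' p
   + \sum_p (misl_weight x p)%:C * freq x p * (freq x' p)^*
   - \sum_p (misl_weight x p)%:C * (freq x p)^* * freq x p
   - \sum_p (misl_weight x p)%:C * freq x p * (freq x p)^*.
  rewrite /S -big_split -!sumrB; apply: eq_bigr => p _ /=.
  rewrite /misl_weight rmorphD rmorphB /= [(N%:R ^+ 2)%:C]rmorphXn /=.
  rewrite rmorph_nat spectrumE. ring.
rewrite !sum_misl_weight !sum_misl_weight_conj /phase_gap mulr_sumr rmorph_sum.
rewrite -big_split -!sumrB; apply: eq_bigr => n _ /=.
rewrite mulrBr rmorphB /= Re_mulC2 rmorphM /=.
have [t yt ->] := st n.
(* Where y_n = 0 both sides vanish, so the arbitrary phase [t] does no harm. *)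
have yE : misl_y x n 0 * (expi t)^* = `|misl_y x n 0|.
  by rewrite [in LHS]yt -mulrA -normCK norm_expi expr1n mulr1.
have yE' : (misl_y x n 0)^* * expi t = `|misl_y x n 0|.
  by rewrite -[LHS]conjCK rmorphM /= conjCK yE geC0_conj.
rewrite yE yE' rmorph_nat normc_norm; ring.
Qed.

Lemma phase_gap_term_ge0 (R : realType) N (x : 'cV[R[i]]_N) n :
  unimodular x ->
  0 <= Normc.normc (misl_y x n 0) - complex.Re ((misl_y x n 0)^* * x n 0).
Proof.
move=> /(_ n) ux; rewrite subr_ge0 -lecR.
have -> : (Normc.normc (misl_y x n 0))%:C = `|(misl_y x n 0)^* * x n 0|.
  by rewrite normrM ux mulr1 norm_conjC.
by rewrite (le_trans _ (normc_ge_Re _)) // lecR ler_norm.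
Qed.

(** All terms of the gap are nonnegative, so each one vanishes; this is the equality case of
    Cauchy-Schwarz in the plane for y_n and the unit vector x_n. *)
Lemma phase_gap_eq0 (R : realType) N (x : 'cV[R[i]]_N) n :
  unimodular x -> phase_gap x = 0 ->
  misl_y x n 0 = (Normc.normc (misl_y x n 0))%:C * x n 0.
Proof.
move=> ux /eqP; rewrite psumr_eq0 => [|i _]; last exact: phase_gap_term_ge0.
move=> /allP/(_ n); rewrite mem_index_enum => /(_ isT) /=.
rewrite subr_eq0 => /eqP.
have := ux n; set y := misl_y x n 0; case: y (x n 0) => a b [c d].
rewrite normc_def => -[/(congr1 (fun r => r ^+ 2))].
rewrite sqr_sqrtr ?addr_ge0 ?sqr_ge0 // expr1n /= => cd1.
rewrite mulNr opprK => e.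
have := sqr_sqrtr (addr_ge0 (sqr_ge0 a) (sqr_ge0 b)); rewrite e => ab.
(* Squared distance from y_n to its projection on x_n; [ab] says that the projection is as long as
   y_n. *)
have s0 : (a - (a * c + b * d) * c) ^+ 2 + (b - (a * c + b * d) * d) ^+ 2 = 0.
  transitivity (a ^+ 2 + b ^+ 2 - 2 * (a * c + b * d) ^+ 2
    + (a * c + b * d) ^+ 2 * (c ^+ 2 + d ^+ 2)); first by ring.
  by rewrite cd1 ab; ring.
move/eqP: s0; rewrite paddr_eq0 ?sqr_ge0 // !sqrf_eq0 !subr_eq0.
by move=> /andP[/eqP ea /eqP eb]; congr (_ +i* _); rewrite ?mul0r ?subr0 ?addr0.
Qed.

(** * Continuity of the phase gap *)

Lemma Re_continuous (R : realType) :
  continuous (@complex.Re R : R[i]^o -> R^o).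
Proof.
move=> z; apply/(@cvgrPdist_lt R R^o _ _ (nbhs_filter z)) => e e0.
apply/(@nbhs_normP _ R[i]^o); exists e%:C => /= [|w]; first by rewrite ltcR.
rewrite -ltcR; apply: le_lt_trans; rewrite -raddfB.
exact: normc_ge_Re.
Qed.

Lemma real_complex_continuous (R : realType) :
  continuous (real_complex R : R^o -> R[i]^o).
Proof.
move=> z; apply/(@cvgrPdist_lt _ R[i]^o _ _ (nbhs_filter z)) => -[e e'].
(* A positive element of [R[i]] has zero imaginary part, so the radius is real. *)
rewrite ltcE /= => /andP[/eqP -> e0].
apply/(@nbhs_normP _ R^o); exists e => //= w.
by rewrite -rmorphB normc_def /= expr0n addr0 sqrtr_sqr ltcR.
Qed.

Lemma conjC_continuous (R : realType) :
  continuous (Num.conj : R[i]^o -> R[i]^o).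
Proof.
move=> z; apply/(@cvgrPdist_lt _ R[i]^o _ _ (nbhs_filter z)) => e e0.
apply/(@nbhs_normP _ R[i]^o).
by exists e => //= w; rewrite -rmorphB norm_conjC.
Qed.

Lemma normc_continuous (R : realType) :
  continuous (@Normc.normc R : R[i]^o -> R^o).
Proof.
move=> z.
have -> : @Normc.normc R = @complex.Re R \o (Num.norm : R[i]^o -> R[i]^o) by [].
apply: continuous_comp; first exact: norm_continuous.
exact: Re_continuous.
Qed.

Lemma sum_continuous_at (T : topologicalType) (K : numFieldType) n
    (f : 'I_n -> T -> K^o) (z : T) :
  (forall i, {for z, continuous (f i)}) ->
  {for z, continuous (fun x => \sum_i f i x : K^o)}.
Proof.
move=> h; apply: (@cvg_big _ _ +%R 0); first exact: add_continuous.
by move=> i _; exact: h.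
Qed.

Lemma freq_continuous (R : realType) N (z : 'cV[R[i]^o]_N) p :
  {for z, continuous (fun x : 'cV[R[i]^o]_N => freq x p : R[i]^o)}.
Proof.
apply: sum_continuous_at => i.
apply: continuousM; first exact: cst_continuous.
exact: coord_continuous.
Qed.

Lemma spectrum_continuous (R : realType) N (z : 'cV[R[i]^o]_N) p :
  {for z, continuous (fun x : 'cV[R[i]^o]_N => spectrum x 0 p : R^o)}.
Proof.
have -> : (fun x : 'cV[R[i]^o]_N => spectrum x 0 p : R^o) =
    (fun x : 'cV[R[i]^o]_N => Normc.normc (freq x p) * Normc.normc (freq x p)).
  by apply/funext => x; rewrite mxE freqE expr2.
have c : {for z, continuous
    (fun x : 'cV[R[i]^o]_N => Normc.normc (freq x p) : R^o)}.
  apply: (@continuous_comp _ _ _ (fun x : 'cV[R[i]^o]_N => freq x p : R[i]^o)).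
    exact: freq_continuous.
  exact: normc_continuous.
exact: continuousM.
Qed.

Lemma spectrum_max_continuous (R : realType) N (z : 'cV[R[i]^o]_N) :
  {for z, continuous (fun x : 'cV[R[i]^o]_N => spectrum_max x : R^o)}.
Proof.
rewrite /spectrum_max.
apply: (@cvg_big R _ Num.max 0 xpredT); first exact: max_continuous.
  exact: nbhs_filter.
by move=> p _; exact: spectrum_continuous.
Qed.

Lemma misl_y_continuous (R : realType) N (z : 'cV[R[i]^o]_N) n :
  {for z, continuous (fun x : 'cV[R[i]^o]_N => misl_y x n 0 : R[i]^o)}.
Proof.
have -> : (fun x : 'cV[R[i]^o]_N => misl_y x n 0 : R[i]^o) = fun x =>
    \sum_p (misl_weight x p)%:C * freq x p * Amx R N n p.
  by apply/funext => x; rewrite misl_yE.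
apply: sum_continuous_at => p.
apply: continuousM; last exact: cst_continuous.
apply: continuousM; last exact: freq_continuous.
apply: (@continuous_comp _ _ _
  (fun x : 'cV[R[i]^o]_N => misl_weight x p : R^o)).
  apply: continuousD; last exact: cst_continuous.
  apply: continuousB; first exact: spectrum_max_continuous.
  exact: spectrum_continuous.
exact: real_complex_continuous.
Qed.

(** The phase of y_n has no limit as y_n tends to 0, but the gap involves y_n only through its
    modulus and a product, both continuous there. *)
Lemma phase_gap_continuous (R : realType) N (z : 'cV[R[i]^o]_N) :
  {for z, continuous (fun x : 'cV[R[i]^o]_N => phase_gap x : R^o)}.
Proof.
apply: sum_continuous_at => n; apply: continuousB.
  apply: (@continuous_comp _ _ _
    (fun x : 'cV[R[i]^o]_N => misl_y x n 0 : R[i]^o)).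
    exact: misl_y_continuous.
  exact: normc_continuous.
apply: (@continuous_comp _ _ _
  (fun x : 'cV[R[i]^o]_N => (misl_y x n 0)^* * x n 0 : R[i]^o)).
  apply: continuousM; last exact: coord_continuous.
  apply: (@continuous_comp _ _ _
    (fun x : 'cV[R[i]^o]_N => misl_y x n 0 : R[i]^o)).
    exact: misl_y_continuous.
  exact: conjC_continuous.
exact: Re_continuous.
Qed.

(** * Passage to limit points *)

Lemma limit_point_continuous (R : realType) N (x : nat -> 'cV[R[i]]_N)
    (z : 'cV[R[i]]_N) (g : 'cV[R[i]^o]_N -> R) (l : R) :
  limit_point_of x z -> {for (z : 'cV[R[i]^o]_N), continuous (g : _ -> R^o)} ->
  (fun k => g (x k)) @ \oo --> (l : R^o) -> g z = l.
Proof.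
move=> hz gz gl; apply/eqP/negPn/negP => ne.
(* At half the distance, a point y that clusters near z and has g y near l contradicts the triangle
   inequality; no subsequence is extracted. *)
pose e := `|g z - l| / 2.
have e0 : 0 < e by rewrite divr_gt0 ?normr_gt0 ?subr_eq0.
have A : ((x : nat -> 'cV[R[i]^o]_N) @ \oo) [set y | `|l - g y| < e].
  exact: (@cvgr_dist_lt _ R^o _ _ _ _ _ gl _ e0).
have B : nbhs (z : 'cV[R[i]^o]_N) [set y | `|g z - g y| < e].
  exact: (@cvgr_dist_lt _ R^o _ _ _ _ _ gz _ e0).
have [y [/= yl yz]] := hz _ _ A B.
have : `|g z - l| < `|g z - l|.
  rewrite [ltRHS]splitr -/e -[g z - l](subrKA (g y)).
  by rewrite (le_lt_trans (ler_normD _ _)) // ltrD // distrC.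
by rewrite ltxx.
Qed.

(** The energies decrease and are bounded below by 0, hence converge; their consecutive differences
    tend to 0 and dominate the gaps. *)
Lemma phase_gap_limit (R : realType) N (x : nat -> 'cV[R[i]]_N) :
  unimodular (x 0%N) -> (forall k, misl_step (x k) (x k.+1)) ->
  (fun k => phase_gap (x k)) @ \oo --> (0 : R^o).
Proof.
move=> u0 st.
have uk k : unimodular (x k).
  by case: k => // k; exact: misl_step_unimodular (st k).
have desc k := energy_descent (uk k) (st k).
have gap0 k : 0 <= phase_gap (x k).
  by apply: sumr_ge0 => n _; exact: phase_gap_term_ge0.
have Ecvg : cvgn (fun k => energy (x k)).
  apply: nonincreasing_is_cvgn.
    apply/nonincreasing_seqP => k.
    by rewrite (le_trans _ (desc k)) // lerDl mulr_ge0.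
  by exists 0 => _ [k _ <-]; apply: sumr_ge0 => p _; exact: sqr_ge0.
have Ecvg' : (fun k => energy (x k) - energy (x k.+1)) @ \oo --> (0 : R^o).
  rewrite -(subrr (limn (fun k => energy (x k)))).
  have S : (fun k => energy (x k.+1)) @ \oo --> limn (fun k => energy (x k)).
    by rewrite (cvg_shiftS (fun k => energy (x k))).
  exact: (cvgB Ecvg S).
apply: (@squeeze_cvgr _ _ _ _ (fun=> 0)
  (fun k => energy (x k) - energy (x k.+1))).
- near=> k; rewrite gap0 /= lerBrDl (le_trans _ (desc k)) // lerD2l.
  by rewrite ler_peMl ?ler1n.
- exact: cvg_cst.
- exact: Ecvg'.
Unshelve. all: by end_near. Qed.

(** * Gradient of the real objective *)

Lemma real_objective_realify (R : realType) N (x : 'cV[R[i]]_N) :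
  real_objective (realify x) = energy x.
Proof.
apply: complexI; rewrite -objectiveE /objective /energy rmorph_sum.
apply: eq_bigr => p _ /=; rewrite rmorphXn /= spectrumE; congr (_ ^+ 2).
rewrite -mulmxA mxE big_ord1 freqE; congr (_ * _).
rewrite mxE /freq /dotc rmorph_sum; apply: eq_bigr => n _.
by rewrite !mxE rmorphM /= conjCK mulrC.
Qed.

Definition complexify (R : realType) N (v : 'cV[R]_(N + N)) : 'cV[R[i]]_N :=
  \col_n (v (lshift N n) 0 +i* v (rshift N n) 0).

Lemma complexifyK (R : realType) N : cancel (@complexify R N) (@realify R N).
Proof.
move=> v; apply/colP => i; rewrite /realify; case: (split_ordP i) => n ->.
  by rewrite col_mxEu !mxE.
by rewrite col_mxEd !mxE.
Qed.

(** This is 4 A Diag(p) A^H x, twice the Wirtinger derivative of the energy in the conjugate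
    variable. *)
Definition energy_gradient (R : realType) N (x : 'cV[R[i]]_N) :
    'cV[R[i]]_N :=
  \col_n (4 * \sum_p (spectrum x 0 p)%:C * freq x p * Amx R N n p).

Lemma realifyD (R : realType) N (t : R) (v x : 'cV[R[i]]_N) :
  t *: realify v + realify x = realify (t%:C *: v + x).
Proof.
rewrite /realify scale_col_mx add_col_mx; congr col_mx; apply/colP => i;
  by rewrite !mxE; case: (v i 0) (x i 0) => a b [c d] /=; ring.
Qed.

Lemma freqD (R : realType) N (t : R) (v x : 'cV[R[i]]_N) p :
  freq (t%:C *: v + x) p = t%:C * freq v p + freq x p.
Proof.
rewrite /freq /dotc mulr_sumr -big_split; apply: eq_bigr => n _ /=.
by rewrite !mxE; ring.
Qed.

Lemma spectrumD (R : realType) N (t : R) (v x : 'cV[R[i]]_N) p :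
  spectrum (t%:C *: v + x) 0 p = spectrum x 0 p
    + t * (2 * complex.Re ((freq x p)^* * freq v p)) + t * t * spectrum v 0 p.
Proof.
apply: complexI.
rewrite !rmorphD /= [(t * (2 * _))%:C]rmorphM [(t * t * _)%:C]rmorphM /=.
rewrite [(t * t)%:C]rmorphM /= Re_mulC2 !spectrumE freqD rmorphD rmorphM /=.
rewrite conj_real_complex; ring.
Qed.

(** The difference quotients of [f] along the line are those of P at 0, so directional derivatives
    reduce to formal differentiation. *)
Lemma derive_along_line (R : realType) m (f : 'cV[R]_m -> R) (a v : 'cV[R]_m)
    (P : {poly R}) :
  (forall t, f (t *: v + a) = P.[t]) -> 'D_v f a = P^`().[0].
Proof.
move=> fP; rewrite derivE derive1E /derive.
have f0 : f a = P.[0] by rewrite -fP scale0r add0r.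
suff -> : (fun h : R => h^-1 *: ((f \o shift a) (h *: v) - f a)) =
  (fun h : R => h^-1 *: ((horner P \o shift 0) (h *: 1) - P.[0])) by [].
by apply/funext => h; rewrite /= fP f0 addr0 [h *: 1]mulr1.
Qed.

Lemma gradient_real_objective (R : realType) N (x : 'cV[R[i]]_N) :
  gradient (@real_objective R N) (realify x) = realify (energy_gradient x).
Proof.
apply/colP => i; rewrite mxE; set e := delta_mx i 0.
have [v ev] : exists v, e = realify v.
  by exists (complexify e); rewrite complexifyK.
pose a p := spectrum x 0 p.
pose b p := 2 * complex.Re ((freq x p)^* * freq v p).
(* The quartic that the energy follows along direction [v], by [spectrumD]; only its linear
   coefficient, the sum of 2 a_p b_p, survives at 0. *)
pose P : {poly R} := \sum_p ((a p)%:P + (b p)%:P * 'X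
  + (spectrum v 0 p)%:P * 'X * 'X) ^+ 2.
rewrite (@derive_along_line _ _ _ _ _ P) => [|t]; last first.
  rewrite ev realifyD real_objective_realify horner_sum; apply: eq_bigr => p _.
  by rewrite !hornerE spectrumD -/(a p) -/(b p); congr (_ ^+ 2); ring.
transitivity ((e^T *m realify (energy_gradient x)) 0 0); last first.
  by rewrite trmx_delta -rowE mxE.
rewrite ev realify_dot mxE.
have -> : P^`().[0] = \sum_p 2 * a p * b p.
  rewrite /P raddf_sum horner_sum; apply: eq_bigr => p _ /=.
  by rewrite !poly.derivE !hornerE /b /=; ring.
transitivity (complex.Re (\sum_p 4 * (a p)%:C * ((freq v p)^* * freq x p))).
  have ReS := raddf_sum (@complex.Re R : Rcomplex R -> R).
  rewrite ReS; apply: eq_bigr => p _; rewrite /b.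
  by case: (freq x p) (freq v p) => c d [c' d'] /=; ring.
congr complex.Re.
under [RHS]eq_bigr do rewrite !mxE mulrCA !mulr_sumr.
rewrite exchange_big; apply: eq_bigr => p _ /=.
rewrite [freq v p]/freq /dotc rmorph_sum mulr_suml mulr_sumr.
by apply: eq_bigr => n _; rewrite rmorphM /= conjCK; ring.
Qed.

(** Write Diag(p) = (p_max + N^2) I - W and use A A^H = 2N I on the scalar part. *)
Lemma energy_gradientE (R : realType) N (x : 'cV[R[i]]_N) n :
  energy_gradient x n 0 =
  4 * (((spectrum_max x + N%:R ^+ 2) * (2 * N)%:R)%:C * x n 0
       - misl_y x n 0).
Proof.
have e : (2 * N)%:R * x n 0 = \sum_p freq x p * Amx R N n p.
  rewrite (eq_bigr (fun p => \sum_i Amx R N n p * (Amx R N i p)^* * x i 0)).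
    rewrite exchange_big (bigD1 n) //= -mulr_suml Amx_gram eqxx mulr1n.
    rewrite big1 ?addr0 // => i ni.
    by rewrite -mulr_suml Amx_gram eq_sym (negbTE ni) mulr0n mul0r.
  move=> p _; rewrite /freq /dotc mulr_suml; apply: eq_bigr => i _; ring.
rewrite mxE misl_yE rmorphM rmorph_nat /= -mulrA e; congr (_ * _).
rewrite mulr_sumr -sumrB; apply: eq_bigr => p _.
rewrite /misl_weight; rewrite !rmorphD rmorphN /=; ring.
Qed.

(** * Tangent cone of the torus and stationarity *)

Lemma tangent_real_feasible (R : realType) N (z d : 'cV[R]_(N + N)) :
  real_feasible z -> tangent_cone (@real_feasible R N) z d ->
  forall n : 'I_N, z (lshift N n) 0 * d (lshift N n) 0
    + z (rshift N n) 0 * d (rshift N n) 0 = 0.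
Proof.
move=> fz [-> n|]; first by rewrite !mxE !mulr0 addr0.
move=> [d0 [u [fu uz du]]] n.
set l := lshift N n; set r := rshift N n.
pose c i := (enorm (u i - z))^-1.
have coord k : (fun i => c i * (u i k 0 - z k 0)) @ \oo -->
    ((enorm d)^-1 * d k 0 : R^o).
  have := cvg_comp _ _ du (@coord_continuous R _ _ k 0 _).
  rewrite mxE; apply: cvg_trans; apply: near_eq_cvg.
  by apply: nearW => i; rewrite /= !mxE.
have coordz k : (fun i => u i k 0 - z k 0) @ \oo --> (0 : R^o).
  rewrite -(subrr (z k 0)); apply: cvgB; last exact: cvg_cst.
  exact: (cvg_comp _ _ uz (@coord_continuous R _ _ k 0 _)).
(* The scaled difference of squares c_i (u^2 - z^2), factored so that one factor tends to 2 z and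
   the other to d / |d|. Adding both coordinates of a circle gives 0, since u_i and z are
   feasible. *)
pose s k i := (u i k 0 - z k 0 + 2 * z k 0) * (c i * (u i k 0 - z k 0)).
have sl k : s k @ \oo --> ((0 + 2 * z k 0) * ((enorm d)^-1 * d k 0) : R^o).
  apply: cvgM; last exact: coord.
  by apply: cvgD; [exact: coordz | exact: cvg_cst].
have s0 : (fun i => s l i + s r i) = fun=> 0.
  apply/funext => i; have [/(_ n) fui _] := fu i.
  transitivity (c i * ((u i l 0 ^+ 2 + u i r 0 ^+ 2)
                       - (z l 0 ^+ 2 + z r 0 ^+ 2))).
    by rewrite /s; ring.
  by rewrite fui (fz n) subrr mulr0.
have lim : (fun i => s l i + s r i) @ \oo -->
    ((0 + 2 * z l 0) * ((enorm d)^-1 * d l 0)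
     + (0 + 2 * z r 0) * ((enorm d)^-1 * d r 0) : R^o).
  exact: (cvgD (sl l) (sl r)).
rewrite s0 in lim.
have /eqP : (0 + 2 * z l 0) * ((enorm d)^-1 * d l 0)
     + (0 + 2 * z r 0) * ((enorm d)^-1 * d r 0) = 0.
  by apply: (cvg_unique _ lim); [exact: Rhausdorff | exact: cvg_cst].
rewrite !add0r.
have -> : 2 * z l 0 * ((enorm d)^-1 * d l 0)
    + 2 * z r 0 * ((enorm d)^-1 * d r 0) =
  2 * (enorm d)^-1 * (z l 0 * d l 0 + z r 0 * d r 0) by ring.
rewrite !mulf_eq0 pnatr_eq0 invr_eq0 /= => /orP[|/eqP //].
(* The remaining case |d| = 0 contradicts that d is nonzero. *)
rewrite sqrtr_eq0 => dle; exfalso; apply: d0; apply/colP => k; rewrite mxE.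
have : \sum_i d i 0 ^+ 2 == 0.
  by rewrite eq_le dle sumr_ge0 // => i _; exact: sqr_ge0.
rewrite psumr_eq0 => [|i _]; last exact: sqr_ge0.
by move=> /allP/(_ k); rewrite mem_index_enum sqrf_eq0 => /(_ isT)/eqP.
Qed.

Lemma phase_gap_eq0_stationary (R : realType) N (z : 'cV[R[i]]_N) :
  unimodular z -> phase_gap z = 0 ->
  stationary_point (@real_objective R N) (@real_feasible R N) (realify z).
Proof.
move=> uz gz; have fz := (unimodularE z).1 uz.
split=> // d /(tangent_real_feasible fz) tan.
rewrite gradient_real_objective.
suff -> : ((realify (energy_gradient z))^T *m d) 0 0 = 0 by [].
rewrite mxE big_split_ord /= -big_split big1 //= => n _.
have := tan n; rewrite ![_^T _ _]mxE /realify.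
rewrite !col_mxEu !col_mxEd !mxE => tn.
(* The real Lagrange multiplier of the n-th circle, obtained by substituting y_n = |y_n| z_n in
   [energy_gradientE]. *)
pose r := 4 * ((spectrum_max z + N%:R ^+ 2) * (2 * N)%:R
               - Normc.normc (misl_y z n 0)).
have -> : 4 * (\sum_p (spectrum z 0 p)%:C * freq z p * Amx R N n p) =
    r%:C * z n 0.
  have := energy_gradientE z n; rewrite mxE => ->.
  rewrite phase_gap_eq0 // /r [(4 * _)%:C]rmorphM rmorph_nat rmorphB /=; ring.
move: tn; case: (z n 0) => a b /= tn.
transitivity (r * (a * d (lshift N n) 0 + b * d (rshift N n) 0)); first by ring.
by rewrite tn mulr0.
Qed.

Theorem theorem5 (R : realType) (N : nat) (x : nat -> 'cV[R[i]]_N)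
    (hN : (1 <= N)%N)
    (hx0 : unimodular (x 0%N))
    (hstep : forall k : nat, misl_step (x k) (x k.+1))
    (z : 'cV[R[i]]_N) (hz : limit_point_of x z) :
  complex_stationary z.
Proof.
have uz : unimodular z.
  move=> n; rewrite -normc_norm; congr (_%:C).
  (* The torus is closed: the modulus of the n-th coordinate is continuous and constantly 1 along
     the sequence. *)
  apply: (limit_point_continuous (g := fun y => Normc.normc (y n 0)) hz).
    apply: (@continuous_comp _ _ _ (fun y : 'cV[R[i]^o]_N => y n 0 : R[i]^o)).
      exact: coord_continuous.
    exact: normc_continuous.
  suff -> : (fun k => Normc.normc (x k n 0)) = fun=> 1 by exact: cvg_cst.
  apply/funext => k; apply: complexI; rewrite normc_norm.
  by case: k => [|k]; [exact: hx0 | exact: misl_step_unimodular (hstep k) n].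
split=> //; apply: phase_gap_eq0_stationary => //.
apply: (limit_point_continuous (g := @phase_gap R N) hz).
  exact: phase_gap_continuous.
exact: phase_gap_limit.
Qed.
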